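(* Let $(L,[-,-],\alpha)$ be a Hom-Leibniz algebra, and let $I^\infty\subset\overline{F}(L)$ be the submodule defined in the context. Then: 1. $I^\infty$ is a two-sided ideal in $\overline{F}(L)$ that is closed under $\alpha_F$. 2. The quotient module $U_{HLeib}(L)=\overline{F}(L)/I^\infty$, equipped with the maps induced by $\dashv$, $\vdash$ and $\alpha_F$, is a Hom-dialgebra. 3. The functor $U_{HLeib}\colon\mathbf{HomLeib}\to\mathbf{HomDi}$ is left adjoint to the functor $HLeib\colon\mathbf{HomDi}\to\mathbf{HomLeib}$.
   Context: $\mathbb{K}$ is a field of characteristic $0$; modules, $\otimes$, $\operatorname{End}$ are over $\mathbb{K}$. A Hom-module is a pair $(V,\alpha)$ with $V$ a module and $\alpha\in\operatorname{End}(V)$ linear. **Hom-Leibniz algebras.** A Hom-Leibniz algebra is a triple $(L,[-,-],\alpha)$ with $L$ a module, $[-,-]\colon L^{\otimes2}\to L$ bilinear, $\alpha\in\operatorname{End}(L)$, such that for all $x,y,z\in L$ $$[[x,y],\alpha(z)]=[[x,z],\alpha(y)]+[\alpha(x),[y,z]].$$ Morphisms are linear maps commuting with brackets and with the maps $\alpha$; the category is $\mathbf{HomLeib}$. **Hom-dialgebras.** A Hom-dialgebra is a tuple $(D,\dashv,\vdash,\alpha)$ with $D$ a module, $\dashv,\vdash\colon D^{\otimes2}\to D$ bilinear, $\alpha\in\operatorname{End}(D)$, such that for all $x,y,z\in D$ $$\alpha(x)\dashv(y\dashv z)=(x\dashv y)\dashv\alpha(z)=\alpha(x)\dashv(y\vdash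 z),\qquad (x\vdash y)\dashv\alpha(z)=\alpha(x)\vdash(y\dashv z),$$ $$(x\dashv y)\vdash\alpha(z)=\alpha(x)\vdash(y\vdash z)=(x\vdash y)\vdash\alpha(z).$$ Morphisms are linear maps compatible with $\alpha$, $\dashv$, $\vdash$; the category is $\mathbf{HomDi}$. The functor $HLeib\colon\mathbf{HomDi}\to\mathbf{HomLeib}$ sends $(D,\dashv,\vdash,\alpha)$ to the Hom-Leibniz algebra $(D,[-,-],\alpha)$ with $[x,y]=x\dashv y-y\vdash x$, and is the identity on underlying linear maps of morphisms. **Diweighted trees.** For $n\ge1$, $T_n$ is the set of planar binary trees with $n$ leaves and one root (each has $n-1$ internal vertices, and for $n\ge2$ the lowest one is connected to the root). A diweighted $n$-tree is a pair $\tau=(\psi,w)$ with $\psi\in T_n$ and $w$ a function from the internal vertices of $\psi$ to $\mathbb{Z}_{\ge0}\times\{\dashv,\vdash\}$; the set of these is $T^{di}_n$ ($T^{di}_1=T_1$ has one element). For $\tau\in T^{di}_n$, $\tau'\in T^{di}_m$, the left grafting $\tau\vee_l\tau'\in T^{di}_{n+m}$ joins the roots of $\tau$ (left) and $\tau'$ (right) to form a new lowest internal vertex connected to a new root; the new vertex has weight $(0,\dashv)$ and all other weights are kept. The right grafting $\tau\vee_r\tau'$ is the same except that the new vertex has weight $(0,\vdash)$. For $m\ge0$, $\tau[m]$ is $\tau$ with $m$ added to the integer component of the weight of the lowest internal vertex. **The algebra $\overline{F}(V)$.** For a Hom-module $(V,\alpha_V)$, $\overline{F}(V)=\bigoplus_{n\ge1}\bigoplus_{\tau\in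 T^{di}_n}V^{\otimes n}_\tau$, where $V^{\otimes n}_\tau$ is a copy of $V^{\otimes n}$, with generators $(x_1\otimes\cdots\otimes x_n)_\tau$. Bilinear operations: $$(x_1\otimes\cdots\otimes x_n)_\tau\dashv(x_{n+1}\otimes\cdots\otimes x_{n+m})_\sigma=(x_1\otimes\cdots\otimes x_{n+m})_{\tau\vee_l\sigma},$$ $$(x_1\otimes\cdots\otimes x_n)_\tau\vdash(x_{n+1}\otimes\cdots\otimes x_{n+m})_\sigma=(x_1\otimes\cdots\otimes x_{n+m})_{\tau\vee_r\sigma}.$$ The linear map $\alpha_F$ is $\alpha_V$ on $V$ (the $n=1$ summand), and $\alpha_F\big((x_1\otimes\cdots\otimes x_n)_\tau\big)=(x_1\otimes\cdots\otimes x_n)_{\tau[1]}$ for $n\ge2$. **Ideals.** The two-sided ideal $\langle S\rangle$ of $\overline{F}(V)$ generated by a nonempty subset $S$ is the submodule spanned by all parenthesized monomials $x_1*\cdots*x_n$ ($n\ge1$, any parenthesization, each $*\in\{\dashv,\vdash\}$, $x_i\in\overline{F}(V)$) with at least one $x_j\in S$; that is, the smallest submodule containing $S$ that is closed under left and right multiplication, via both $\dashv$ and $\vdash$, by all elements of $\overline{F}(V)$. It need not be closed under $\alpha_F$. **The ideal $I^\infty$ and the functor $U_{HLeib}$.** For a Hom-Leibniz algebra $(L,[-,-],\alpha)$, let $I^1$ be the two-sided ideal of $\overline{F}(L)$ generated by the images of the five maps $\overline{F}(L)^{\otimes 3}\to\overline{F}(L)$ $$\dashv\circ(\dashv\otimes\alpha_F)-\dashv\circ(\alpha_F\otimes\dashv),\quad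 \dashv\circ(\dashv\otimes\alpha_F)-\dashv\circ(\alpha_F\otimes\vdash),\quad \dashv\circ(\vdash\otimes\alpha_F)-\vdash\circ(\alpha_F\otimes\dashv),$$ $$\vdash\circ(\alpha_F\otimes\vdash)-\vdash\circ(\vdash\otimes\alpha_F),\quad \vdash\circ(\alpha_F\otimes\vdash)-\vdash\circ(\dashv\otimes\alpha_F),$$ together with the elements $[x,y]-(x\dashv y-y\vdash x)$ for $x,y\in L$, where $L$ is identified with the $n=1$ summand of $\overline{F}(L)$. Inductively, $I^{n+1}=\langle I^n\cup\alpha_F(I^n)\rangle$, and $I^\infty=\bigcup_{n\ge1}I^n$. On morphisms, $U_{HLeib}(f)$ is induced by $(x_1\otimes\cdots\otimes x_n)_\tau\mapsto(f(x_1)\otimes\cdots\otimes f(x_n))_\tau$. *)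

(* Defs.v *)
From HB Require Import structures.
From mathcomp Require Import all_boot all_order all_algebra sesquilinear.
From mathcomp Require Import finmap.
From mathcomp Require Import boolp classical_sets cardinality fsbigop.
From mathcomp Require Import generic_quotient ring_quotient freeg.

Set Implicit Arguments.
Unset Strict Implicit.
Unset Printing Implicit Defensive.

Import GRing.Theory.
Local Open Scope classical_set_scope.
Local Open Scope quotient_scope.
Local Open Scope ring_scope.

Section LinearQuotient.
Variables (K : fieldType) (M : lmodType K).

Definition is_submod (N : set M) : Prop :=
  N 0 /\ forall (a : K) (u v : M), N u -> N v -> N (a *: u + v).

Record submod := Submod { submod_set :> M -> Prop; submodP : is_submod submod_set }.

Definition submod_pred (N : submod) : {pred M} := fun x => `[< N x >].

Lemma submod_pred_closed (N : submod) : submod_closed (submod_pred N).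
Proof.
split=> [|a u v /asboolP Nu /asboolP Nv]; first exact/asboolP/(submodP N).1.
exact/asboolP/(submodP N).2.
Qed.

HB.instance Definition _ (N : submod) :=
  GRing.isSubmodClosed.Build K M (submod_pred N) (submod_pred_closed N).

Definition lquot (N : submod) := Quotient.quot (submod_pred N).

HB.instance Definition _ (N : submod) := GRing.Zmodule.on (lquot N).

Definition lpi (N : submod) (x : M) : lquot N :=
  \pi_(Quotient.quot (submod_pred N)) x.
Definition lrepr (N : submod) (q : lquot N) : M :=
  repr (q : Quotient.quot (submod_pred N)).

Lemma lreprK N : cancel (@lrepr N) (@lpi N).
Proof. exact: reprK. Qed.

Lemma lpi_eq N x y : lpi N x = lpi N y <-> N (x - y).
Proof.
split=> [/eqP|Nxy]; first by rewrite -Quotient.idealrBE => /asboolP.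
by apply/eqP; rewrite -Quotient.idealrBE; apply/asboolP.
Qed.

Lemma lpiD N : {morph lpi N : x y / x + y}.
Proof. exact: raddfD. Qed.

Definition lquot_scale N (a : K) (q : lquot N) : lquot N :=
  lpi N (a *: lrepr q).

Lemma lpiZ N a x : lpi N (a *: x) = lquot_scale a (lpi N x).
Proof.
apply/lpi_eq; rewrite -scalerBr -[_ *: _]addr0.
apply: (submodP N).2; last exact: (submodP N).1.
by apply/lpi_eq; rewrite lreprK.
Qed.

Lemma lquot_scaleA N a b (q : lquot N) :
  lquot_scale a (lquot_scale b q) = lquot_scale (a * b) q.
Proof. by rewrite -[q]lreprK -!lpiZ scalerA. Qed.

Lemma lquot_scale1 N : left_id 1 (@lquot_scale N).
Proof. by move=> q; rewrite -[q]lreprK -lpiZ scale1r. Qed.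

Lemma lquot_scaleDr N : right_distributive (@lquot_scale N) +%R.
Proof.
by move=> a p q; rewrite -[p]lreprK -[q]lreprK -lpiD -!lpiZ -lpiD scalerDr.
Qed.

Lemma lquot_scaleDl N (q : lquot N) :
  {morph (@lquot_scale N)^~ q : a b / a + b}.
Proof. by move=> a b; rewrite /= -[q]lreprK -!lpiZ -lpiD scalerDl. Qed.

HB.instance Definition _ (N : submod) :=
  GRing.Zmodule_isLmodule.Build K (lquot N)
    (@lquot_scaleA N) (@lquot_scale1 N) (@lquot_scaleDr N) (@lquot_scaleDl N).

Lemma lpi_linear N : linear (lpi N).
Proof. by move=> a x y; rewrite lpiD lpiZ. Qed.

HB.instance Definition _ N := GRing.isLinear.Build K M (lquot N) _ (lpi N)
  (@lpi_linear N).

Lemma smallest_submod (S : set M) : is_submod (smallest is_submod S).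
Proof.
split=> [N [[N0 _] _] //|a u v Su Sv N NS].
by apply: NS.1.2; [apply: Su | apply: Sv].
Qed.

Definition lspan (S : set M) : submod := Submod (smallest_submod S).

End LinearQuotient.

Section TensorPower.
Variables (K : fieldType) (V : lmodType K) (n : nat).

Definition tset (t : n.-tuple V) (i : 'I_n) (x : V) : n.-tuple V :=
  [tuple if j == i then x else tnth t j | j < n].

Definition multilinear (W : lmodType K) (phi : n.-tuple V -> W) : Prop :=
  forall (t : n.-tuple V) (i : 'I_n), linear (fun x => phi (tset t i x)).

Definition tensor_rel : set {freeg (n.-tuple V) / K} :=
  [set r | exists (t : n.-tuple V) (i : 'I_n) (a : K) (x y : V),
     r = << tset t i (a *: x + y) >>
         - (a *: << tset t i x >> + << tset t i y >>)].

Definition tpow : lmodType K := lquot (lspan tensor_rel).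

Definition tpure (t : n.-tuple V) : tpow := lpi _ << t >>.

(* The linear map out of the tensor power determined by phi; meaningful only
   when phi is multilinear (see tlift_pure). *)
Definition tlift (W : lmodType K) (phi : n.-tuple V -> W) (x : tpow) : W :=
  fglift phi (lrepr x).

Lemma fglift_linear (W : lmodType K) (phi : n.-tuple V -> W) :
  linear (fglift phi).
Proof.
have subF := @lift_is_additive K _ W phi.
have F0 : fglift phi 0 = 0 by rewrite -(subrr 0) subF subrr.
have oppF D : fglift phi (- D) = - fglift phi D 
  by rewrite -sub0r subF F0 sub0r.
have addF : {morph fglift phi : D E / D + E}.
  by move=> D E; rewrite -{1}(opprK E) subF oppF opprK.
have sumF := big_morph _ addF F0.
move=> a D E; rewrite addF; congr (_ + _).
have <- : fglift phi (\sum_(t <- dom D) << coeff t D *g t >>) = fglift phi D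
  by rewrite freeg_sumE.
rewrite [in RHS]sumF scaler_sumr /GRing.scale /= /fgscale sumF.
by apply: eq_bigr => t _; rewrite !liftU -scalerA.
Qed.

HB.instance Definition _ (W : lmodType K) (phi : n.-tuple V -> W) :=
  GRing.isLinear.Build K {freeg (n.-tuple V) / K} W _ (fglift phi)
    (fglift_linear phi).

Lemma tlift_pi (W : lmodType K) (phi : n.-tuple V -> W) :
  multilinear phi -> forall D, tlift phi (lpi _ D) = fglift phi D.
Proof.
move=> mphi D; apply/eqP; rewrite -subr_eq0 -linearB /=; apply/eqP.
have /lpi_eq := lreprK (lpi (lspan tensor_rel) D).
apply: (fun H => H [set E | fglift phi E = 0] _); split.
  split=> [|a u v /= u0 v0]; first exact: linear0.
  by rewrite fglift_linear u0 v0 scaler0 addr0.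
move=> _ [t [i [a [x [y ->]]]]] /=.
by rewrite linearB /= fglift_linear !liftU !scale1r mphi subrr.
Qed.

Lemma tlift_pure (W : lmodType K) (phi : n.-tuple V -> W) :
  multilinear phi -> forall t, tlift phi (tpure t) = phi t.
Proof. by move=> mphi t; rewrite tlift_pi// liftU scale1r. Qed.

Lemma tlift_linear (W : lmodType K) (phi : n.-tuple V -> W) :
  multilinear phi -> linear (tlift phi).
Proof.
move=> mphi a x y; rewrite -[x]lreprK -[y]lreprK -linearP !tlift_pi//.
exact: linearP.
Qed.

Lemma tpure_multilinear : multilinear tpure.
Proof.
move=> t i a x y; rewrite -linearP; apply/lpi_eq.
by apply: sub_gen_smallest; exists t, i, a, x, y.
Qed.

Lemma tpow_ind (P : tpow -> Prop) :
  P 0 -> (forall a t x, P x -> P (a *: tpure t + x)) -> forall x, P x.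
Proof.
move=> P0 PD x; rewrite -[x]lreprK -[lrepr x]freeg_sumE linear_sum /=.
elim: (dom _) => [|t s IHs]; first by rewrite big_nil.
rewrite big_cons.
have -> c : lpi (lspan tensor_rel) << c *g t >> = c *: tpure t.
  rewrite -linearZ /=; congr (lpi _ _).
  by apply/eqP/freeg_eqP => s'; rewrite coeffZ !coeffU mul1r.
exact: PD.
Qed.

End TensorPower.

Section DirectSum.
Variables (K : fieldType) (I : choiceType) (M : I -> lmodType K).

Record dsum := DSum {
  dsum_fun :> forall i, M i;
  dsum_finP : `[< finite_set [set i | dsum_fun i != 0] >] }.

HB.instance Definition _ := [isSub for dsum_fun].
HB.instance Definition _ := [Choice of dsum by <:].

Lemma dsumP (x y : dsum) : (forall i, x i = y i) -> x = y.
Proof. by move=> xy; apply/val_inj/functional_extensionality_dep. Qed.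

Lemma dsum_fin (x : dsum) : finite_set [set i | x i != 0].
Proof. exact/asboolP/dsum_finP. Qed.

Lemma dsum0_finP : `[< finite_set [set i | (0 : M i) != 0] >].
Proof.
by apply/asboolP; apply: (sub_finite_set _ (finite_set0 I)) => i /=; rewrite eqxx.
Qed.

Lemma dsumD_finP (x y : dsum) : `[< finite_set [set i | x i + y i != 0] >].
Proof.
apply/asboolP; apply: (sub_finite_set (B := [set i | x i != 0] `|` [set i | y i != 0])).
  move=> i /=; case: (eqVneq (x i) 0) => [->|]; last by left.
  by rewrite add0r; right.
by rewrite finite_setU; split; exact: dsum_fin.
Qed.

Lemma dsumN_finP (x : dsum) : `[< finite_set [set i | - x i != 0] >].
Proof.
by apply/asboolP; apply: (sub_finite_set _ (dsum_fin x)) => i /=; rewrite oppr_eq0.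
Qed.

Lemma dsumZ_finP (a : K) (x : dsum) : `[< finite_set [set i | a *: x i != 0] >].
Proof.
apply/asboolP; apply: (sub_finite_set _ (dsum_fin x)) => i /=.
by rewrite scaler_eq0 negb_or => /andP[].
Qed.

Definition dsum0 := DSum dsum0_finP.
Definition dsumD x y := DSum (dsumD_finP x y).
Definition dsumN x := DSum (dsumN_finP x).
Definition dsumZ a x := DSum (dsumZ_finP a x).

Lemma dsumDA : associative dsumD.
Proof. by move=> x y z; apply: dsumP => i; exact: addrA. Qed.
Lemma dsumDC : commutative dsumD.
Proof. by move=> x y; apply: dsumP => i; exact: addrC. Qed.
Lemma dsumD0 : left_id dsum0 dsumD.
Proof. by move=> x; apply: dsumP => i; exact: add0r. Qed.
Lemma dsumDN : left_inverse dsum0 dsumN dsumD.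
Proof. by move=> x; apply: dsumP => i; exact: addNr. Qed.

HB.instance Definition _ := GRing.isZmodule.Build dsum dsumDA dsumDC dsumD0 dsumDN.

Lemma dsumZA a b x : dsumZ a (dsumZ b x) = dsumZ (a * b) x.
Proof. by apply: dsumP => i; exact: scalerA. Qed.
Lemma dsumZ1 : left_id 1 dsumZ.
Proof. by move=> x; apply: dsumP => i; exact: scale1r. Qed.
Lemma dsumZDr : right_distributive dsumZ +%R.
Proof. by move=> a x y; apply: dsumP => i; exact: scalerDr. Qed.
Lemma dsumZDl x : {morph dsumZ^~ x : a b / a + b}.
Proof. by move=> a b; apply: dsumP => i; exact: scalerDl. Qed.

HB.instance Definition _ :=
  GRing.Zmodule_isLmodule.Build K dsum dsumZA dsumZ1 dsumZDr dsumZDl.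

Definition dinj_fun i (a : M i) (j : I) : M j :=
  if i =P j is ReflectT e then ecast k (M k) e a else 0.

Lemma dinj_finP i (a : M i) : `[< finite_set [set j | dinj_fun a j != 0] >].
Proof.
apply/asboolP; apply: (sub_finite_set _ (finite_set1 i)) => j /=.
by rewrite /dinj_fun; case: eqP => [e|]; [move=> _; exact: esym | rewrite eqxx].
Qed.

Definition dinj i (a : M i) : dsum := DSum (dinj_finP a).

Lemma dinjE i (a : M i) : dinj a i = a.
Proof. by rewrite /= /dinj_fun; case: eqP => // e; rewrite eq_axiomK. Qed.

Lemma dinj_linear i : linear (@dinj i).
Proof.
move=> a x y; apply: dsumP => j.
change (dinj_fun (a *: x + y) j = a *: dinj_fun x j + dinj_fun y j).
rewrite /dinj_fun; case: eqP => [e|_]; last by rewrite scaler0 addr0.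
by case: _ / e.
Qed.

HB.instance Definition _ i := GRing.isLinear.Build K (M i) dsum _ (@dinj i)
  (@dinj_linear i).

(* The linear map out of the direct sum whose restriction to the i-th summand is
   phi i; meaningful only when every phi i is linear. *)
Definition dlift (W : lmodType K) (phi : forall i, M i -> W) (x : dsum) : W :=
  \sum_(i \in [set: I]) phi i (x i).

Lemma dliftE (W : lmodType K) (phi : forall i, M i -> W) (x : dsum) (s : {fset I}) :
  (forall i, linear (phi i)) -> (forall i, x i != 0 -> i \in s) ->
  dlift phi x = \sum_(i <- s) phi i (x i).
Proof.
move=> lphi sP; apply: fsbigTE => i /negP si.
have [->|/sP//] := eqVneq (x i) 0.
by have := lphi i (-1) 0 0; rewrite !scaleN1r !addNr.
Qed.

Lemma dlift_linear (W : lmodType K) (phi : forall i, M i -> W) :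
  (forall i, linear (phi i)) -> linear (dlift phi).
Proof.
move=> lphi a x y.
pose s := (fset_set [set i | x i != 0] `|` fset_set [set i | y i != 0])%fset.
have xs i : x i != 0 -> i \in s.
  by move=> xi; rewrite inE (in_fset_set (dsum_fin x)) mem_set.
have ys i : y i != 0 -> i \in s.
  by move=> yi; rewrite inE orbC (in_fset_set (dsum_fin y)) mem_set.
rewrite !(@dliftE _ _ _ s)//; last first.
  move=> i; apply: contraR => si.
  have -> : (a *: x + y) i = a *: x i + y i by [].
  case: (eqVneq (x i) 0) => [->|/xs]; last by rewrite (negbTE si).
  case: (eqVneq (y i) 0) => [->|/ys]; last by rewrite (negbTE si).
  by rewrite scaler0 addr0.
by rewrite scaler_sumr -big_split; apply: eq_bigr => i _; exact: lphi.
Qed.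

Lemma dlift_inj (W : lmodType K) (phi : forall i, M i -> W) i (a : M i) :
  (forall i, linear (phi i)) -> dlift phi (dinj a) = phi i a.
Proof.
move=> lphi; rewrite (@dliftE _ _ _ [fset i]%fset)// ?big_seq_fset1 ?dinjE//.
by move=> j; rewrite inE /= /dinj_fun; case: eqP => [e _|]; [exact/eqP/esym | rewrite eqxx].
Qed.

Lemma dsum_ind (P : dsum -> Prop) :
  P 0 -> (forall i (a : M i) x, P x -> P (dinj a + x)) -> forall x, P x.
Proof.
move=> P0 PD x.
suff -> : x = \sum_(i <- fset_set [set i | x i != 0]) dinj (x i).
  by elim: (enum_fset _) => [|i s IHs]; rewrite ?big_nil// big_cons; exact: PD.
apply: dsumP => j.
have ev (s : seq I) : (\sum_(i <- s) dinj (x i)) j = \sum_(i <- s) dinj_fun (x i) j.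
  by elim: s => [|i s IHs]; rewrite ?big_nil// !big_cons -IHs.
rewrite ev; have [xj|xj] := eqVneq (x j) 0.
  rewrite xj big1 // => i _; rewrite /dinj_fun; case: eqP => // e.
  by case: _ / e xj => ->.
rewrite (bigD1_seq j)/= ?fset_uniq//; last first.
  by rewrite (in_fset_set (dsum_fin x)) mem_set.
rewrite -[dinj_fun _ _]/(dinj (x j) j) dinjE big1 ?addr0// => i ij.
by rewrite /dinj_fun; case: eqP => // e; rewrite e eqxx in ij.
Qed.

End DirectSum.

Section HomAlgebras.
Variable K : fieldType.

Definition is_bilinear (V : lmodType K) (b : V -> V -> V) : Prop :=
  (forall x, linear (b x)) /\ (forall y, linear (b^~ y)).

Record is_homLeib (L : lmodType K) (br : L -> L -> L) (alpha : L -> L) : Prop :=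
  IsHomLeib {
    homLeib_bilinear : is_bilinear br;
    homLeib_linear : linear alpha;
    homLeib_identity : forall x y z,
      br (br x y) (alpha z) = br (br x z) (alpha y) + br (alpha x) (br y z) }.

Record homLeib := HomLeib {
  hl_mod :> lmodType K;
  hl_br : hl_mod -> hl_mod -> hl_mod;
  hl_alpha : hl_mod -> hl_mod;
  hl_axioms : is_homLeib hl_br hl_alpha }.

Record homLeib_hom (L L' : homLeib) := HomLeibHom {
  hl_fun :> L -> L';
  hl_fun_linear : linear hl_fun;
  hl_fun_br : {morph hl_fun : x y / hl_br x y >-> hl_br x y};
  hl_fun_alpha : {morph hl_fun : x / hl_alpha x >-> hl_alpha x} }.

(* homDi_ll and homDi_lr are the first chain of equalities, homDi_rl the middle one,
   homDi_lrr and homDi_rr the last chain. *)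
Record is_homDi (D : lmodType K) (l r : D -> D -> D) (alpha : D -> D) : Prop :=
  IsHomDi {
    homDi_bilinearl : is_bilinear l;
    homDi_bilinearr : is_bilinear r;
    homDi_linear : linear alpha;
    homDi_ll : forall x y z, l (alpha x) (l y z) = l (l x y) (alpha z);
    homDi_lr : forall x y z, l (l x y) (alpha z) = l (alpha x) (r y z);
    homDi_rl : forall x y z, l (r x y) (alpha z) = r (alpha x) (l y z);
    homDi_lrr : forall x y z, r (l x y) (alpha z) = r (alpha x) (r y z);
    homDi_rr : forall x y z, r (alpha x) (r y z) = r (r x y) (alpha z) }.

(* hd_l is ⊣ and hd_r is ⊢. *)
Record homDi := HomDi {
  hd_mod :> lmodType K;
  hd_l : hd_mod -> hd_mod -> hd_mod;
  hd_r : hd_mod -> hd_mod -> hd_mod;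
  hd_alpha : hd_mod -> hd_mod;
  hd_axioms : is_homDi hd_l hd_r hd_alpha }.

Record homDi_hom (D D' : homDi) := HomDiHom {
  hd_fun :> D -> D';
  hd_fun_linear : linear hd_fun;
  hd_fun_l : {morph hd_fun : x y / hd_l x y >-> hd_l x y};
  hd_fun_r : {morph hd_fun : x y / hd_r x y >-> hd_r x y};
  hd_fun_alpha : {morph hd_fun : x / hd_alpha x >-> hd_alpha x} }.

Lemma homLeib_hom_eq (L L' : homLeib) (f g : homLeib_hom L L') : f =1 g -> f = g.
Proof.
case: f g => [f f1 f2 f3] [g g1 g2 g3] /= /funext fg; subst g.
by congr HomLeibHom; exact: Prop_irrelevance.
Qed.

Lemma homDi_hom_eq (D D' : homDi) (f g : homDi_hom D D') : f =1 g -> f = g.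
Proof.
case: f g => [f f1 f2 f3 f4] [g g1 g2 g3 g4] /= /funext fg; subst g.
by congr HomDiHom; exact: Prop_irrelevance.
Qed.

End HomAlgebras.

Record category := Category {
  obj :> Type;
  hom : obj -> obj -> Type;
  idc : forall a, hom a a;
  compc : forall a b c, hom b c -> hom a b -> hom a c;
  compc1 : forall a b (f : hom a b), compc f (idc a) = f;
  comp1c : forall a b (f : hom a b), compc (idc b) f = f;
  compcA : forall a b c d (f : hom c d) (g : hom b c) (h : hom a b),
    compc f (compc g h) = compc (compc f g) h }.

Record is_functor (C D : category) (F0 : C -> D)
    (F1 : forall a b, hom a b -> hom (F0 a) (F0 b)) : Prop := IsFunctor {
  functor_id : forall a, F1 a a (idc a) = idc (F0 a);
  functor_comp : forall a b c (f : hom b c) (g : hom a b),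
    F1 a c (compc f g) = compc (F1 b c f) (F1 a b g) }.

Record functor (C D : category) := Functor {
  fobj :> C -> D;
  fmap : forall a b, hom a b -> hom (fobj a) (fobj b);
  functorP : is_functor fmap }.

(* F is left adjoint to G: a bijection hom (F c) d ~ hom c (G d), natural in both
   variables. *)
Definition left_adjoint (C D : category) (F : functor C D) (G : functor D C) :
    Prop :=
  exists phi : forall (c : C) (d : D), hom (F c) d -> hom c (G d),
    (forall c d, bijective (phi c d)) /\
    (forall (c c' : C) (d d' : D) (f : hom c' c) (g : hom d d') (h : hom (F c) d),
       phi c' d' (compc g (compc h (fmap F f))) =
       compc (fmap G g) (compc (phi c d h) f)).

Section HLeib.
Variable K : fieldType.

Section HomLeibCategory.
Implicit Types L : homLeib K.

Definition homLeib_id L : homLeib_hom L L :=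
  @HomLeibHom K L L idfun (fun a x y => erefl) (fun x y => erefl)
    (fun x => erefl).

Definition homLeib_comp L1 L2 L3 (f : homLeib_hom L2 L3) (g : homLeib_hom L1 L2) :
  homLeib_hom L1 L3.
Proof.
exists (f \o g) => [a x y|x y|x] /=.
- by rewrite !hl_fun_linear.
- by rewrite !hl_fun_br.
- by rewrite !hl_fun_alpha.
Defined.

End HomLeibCategory.

Definition HomLeibCat : category.
Proof.
exists (homLeib K) (@homLeib_hom K) homLeib_id homLeib_comp => *;
  exact: homLeib_hom_eq.
Defined.

Section HomDiCategory.
Implicit Types D : homDi K.

Definition homDi_id D : homDi_hom D D :=
  @HomDiHom K D D idfun (fun a x y => erefl) (fun x y => erefl)
    (fun x y => erefl) (fun x => erefl).

Definition homDi_comp D1 D2 D3 (f : homDi_hom D2 D3) (g : homDi_hom D1 D2) :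
  homDi_hom D1 D3.
Proof.
exists (f \o g) => [a x y|x y|x y|x] /=.
- by rewrite hd_fun_linear hd_fun_linear.
- by rewrite !hd_fun_l.
- by rewrite !hd_fun_r.
- by rewrite !hd_fun_alpha.
Defined.

End HomDiCategory.

Definition HomDiCat : category.
Proof.
exists (homDi K) (@homDi_hom K) homDi_id homDi_comp => *; exact: homDi_hom_eq.
Defined.

Definition HLeib_br (D : homDi K) (x y : D) : D := hd_l x y - hd_r y x.

Lemma HLeib_axioms (D : homDi K) : is_homLeib (@HLeib_br D) (@hd_alpha K D).
Proof.
case: (hd_axioms D) => [[l1 l2] [r1 r2] al ll lr rl lrr rr].
have E (f : D -> D) : linear f -> {morph f : x y / x - y}.
  by move=> lf x y; rewrite addrC -(scaleN1r y) lf scaleN1r addrC.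
split=> //.
  split=> [x|y] a u v; rewrite /HLeib_br.
    by rewrite l1 r2 scalerBr opprD addrACA.
  by rewrite l2 r1 scalerBr opprD addrACA.
move=> x y z; rewrite /HLeib_br.
rewrite !(E _ (l1 _)) !(E _ (r1 _)) !(E _ (l2 _)) !(E _ (r2 _)).
rewrite -!lr !ll !rl !lrr -!rr -!lrr !opprB.
rewrite [RHS](AC ((2 * 2) * (2 * 2)) ((5 * 4) * (7 * 2) * (1 * 6) * (3 * 8))).
by rewrite /= !subrr !addr0.
Qed.

Definition HLeib_obj (D : homDi K) : homLeib K := HomLeib (HLeib_axioms D).

Definition HLeib_hom (D D' : homDi K) (f : homDi_hom D D') :
  homLeib_hom (HLeib_obj D) (HLeib_obj D').
Proof.
exists (f : D -> D'); [exact: hd_fun_linear | move=> x y | exact: hd_fun_alpha].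
rewrite /= /HLeib_br -hd_fun_l -hd_fun_r addrC -scaleN1r hd_fun_linear scaleN1r.
by rewrite addrC.
Defined.

Lemma HLeib_functor :
  @is_functor HomDiCat HomLeibCat HLeib_obj HLeib_hom.
Proof. by split=> *; exact: homLeib_hom_eq. Qed.

Definition HLeib : functor HomDiCat HomLeibCat := Functor HLeib_functor.

End HLeib.

(* ldi stands for ⊣ and rdi for ⊢. *)
Variant side := ldi | rdi.

(* All diweighted trees, for all n >= 1 at once: each node carries its weight, and
   t is a diweighted n-tree for n = leaves t. *)
Inductive ditree := leaf | node of ditree & ditree & nat & side.

HB.instance Definition _ := gen_eqMixin ditree.
HB.instance Definition _ := gen_choiceMixin ditree.

Fixpoint leaves (t : ditree) : nat :=
  if t is node l r _ _ then (leaves l + leaves r)%N else 1%N.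

Definition graft (s : side) (t u : ditree) : ditree := node t u 0%N s.

Definition add_weight (m : nat) (t : ditree) : ditree :=
  if t is node l r k s then node l r (k + m)%N s else leaf.

Section TensorMaps.
Variable K : fieldType.

Definition tcat (V : lmodType K) n m (x : tpow V n) (y : tpow V m) :
    tpow V (n + m)%N :=
  tlift (fun t => tlift (fun u => tpure [tuple of t ++ u]) y) x.

Definition tmap (V W : lmodType K) n (f : V -> W) : tpow V n -> tpow W n :=
  tlift (fun t => tpure [tuple of map f t]).

Lemma tset_lshift (V : lmodType K) n m (t : n.-tuple V) (u : m.-tuple V) i x :
  [tuple of tset t i x ++ u] = tset [tuple of t ++ u] (lshift m i) x.
Proof.
apply: eq_from_tnth => j; rewrite tnth_mktuple.
case: (split_ordP j) => k ->; rewrite ?(tnth_lshift, tnth_rshift) ?tnth_mktuple.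
  by rewrite (inj_eq (@lshift_inj _ _)).
by rewrite eq_rlshift.
Qed.

Lemma tset_rshift (V : lmodType K) n m (t : n.-tuple V) (u : m.-tuple V) i x :
  [tuple of t ++ tset u i x] = tset [tuple of t ++ u] (rshift n i) x.
Proof.
apply: eq_from_tnth => j; rewrite tnth_mktuple.
case: (split_ordP j) => k ->; rewrite ?(tnth_lshift, tnth_rshift) ?tnth_mktuple.
  by rewrite eq_lrshift.
by rewrite (inj_eq (@rshift_inj _ _)).
Qed.

Lemma tcat_multilinearr (V : lmodType K) n m (t : n.-tuple V) :
  multilinear (fun u : m.-tuple V => tpure [tuple of t ++ u]).
Proof. by move=> u i a x y; rewrite !tset_rshift tpure_multilinear. Qed.

Lemma tcat_multilinearl (V : lmodType K) n m (y : tpow V m) :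
  multilinear (fun t : n.-tuple V =>
    tlift (fun u : m.-tuple V => tpure [tuple of t ++ u]) y).
Proof.
move=> t i a x x'; elim/tpow_ind: y => [|b u y IHy].
  have l0 (t' : n.-tuple V) :
      tlift (fun u : m.-tuple V => tpure [tuple of t' ++ u]) 0 = 0.
    have := tlift_linear (@tcat_multilinearr _ n m t') (-1) 0 0.
    by rewrite !scaleN1r !addNr.
  by rewrite !l0 scaler0 addr0.
rewrite !(tlift_linear (@tcat_multilinearr _ n m _)) IHy.
rewrite !(tlift_pure (@tcat_multilinearr _ n m _)) !tset_lshift.
rewrite tpure_multilinear !scalerDr !scalerA (mulrC b) addrACA //.
Qed.

Lemma tcat_pure (V : lmodType K) n m (t : n.-tuple V) (u : m.-tuple V) :
  tcat (tpure t) (tpure u) = tpure [tuple of t ++ u].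
Proof.
by rewrite /tcat tlift_pure ?tlift_pure//;
  [exact: tcat_multilinearr | exact: tcat_multilinearl].
Qed.

Lemma tcat_linearl (V : lmodType K) n m (y : tpow V m) :
  linear (fun x : tpow V n => tcat x y).
Proof. exact/tlift_linear/tcat_multilinearl. Qed.

Lemma tcat_linearr (V : lmodType K) n m (x : tpow V n) :
  linear (fun y : tpow V m => tcat x y).
Proof.
move=> a y y'; elim/tpow_ind: x => [|b t x IHx].
  have l0 (z : tpow V m) : tcat (0 : tpow V n) z = 0.
    by have := @tcat_linearl V n m z (-1) 0 0; rewrite !scaleN1r !addNr.
  by rewrite !l0 scaler0 addr0.
have tp (z : tpow V m) :
    tcat (tpure t) z = tlift (fun u : m.-tuple V => tpure [tuple of t ++ u]) z
  by exact: (tlift_pure (@tcat_multilinearl _ n m z)).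
rewrite !tcat_linearl IHx !tp (tlift_linear (@tcat_multilinearr _ n m t)).
by rewrite !scalerDr !scalerA (mulrC b) addrACA.
Qed.

Lemma tmap_multilinear (V W : lmodType K) n (f : V -> W) :
  linear f -> multilinear (fun t : n.-tuple V => tpure [tuple of map f t]).
Proof.
move=> lf t i a x y.
have E z : [tuple of map f (tset t i z)] = tset [tuple of map f t] i (f z).
  apply: eq_from_tnth => j.
  by rewrite tnth_map !tnth_mktuple tnth_map; case: ifP.
by rewrite !E lf tpure_multilinear.
Qed.

Lemma tmap_linear (V W : lmodType K) n (f : V -> W) :
  linear f -> linear (@tmap V W n f).
Proof. by move=> lf; exact/tlift_linear/tmap_multilinear. Qed.

Lemma tmap_pure (V W : lmodType K) n (f : V -> W) (t : n.-tuple V) :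
  linear f -> tmap f (tpure t) = tpure [tuple of map f t].
Proof.
by move=> lf; exact: (tlift_pure (tmap_multilinear lf)).
Qed.

End TensorMaps.

Section Fbar.
Variables (K : fieldType) (V : lmodType K) (alpha : V -> V).

(* The double direct sum over n >= 1 and diweighted n-trees, written as one sum. *)
Definition Fbar : lmodType K := dsum (fun t : ditree => tpow V (leaves t)).

Definition finj (t : ditree) (a : tpow V (leaves t)) : Fbar :=
  dinj (M := fun t => tpow V (leaves t)) a.

Definition flift (W : lmodType K) (phi : forall t, tpow V (leaves t) -> W) :
    Fbar -> W :=
  dlift (M := fun t => tpow V (leaves t)) phi.

Definition fgen (t : ditree) (x : (leaves t).-tuple V) : Fbar := finj (tpure x).

Definition feta (x : V) : Fbar := @fgen leaf [tuple x].

Definition fmul (s : side) (x y : Fbar) : Fbar :=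
  flift (fun t a => flift (fun u b => @finj (graft s t u) (tcat a b)) y) x.

Definition falpha : Fbar -> Fbar :=
  flift (fun t => match t return tpow V (leaves t) -> Fbar with
    | leaf => fun a => @finj leaf (tmap alpha a)
    | node l r k s => fun a => @finj (add_weight 1 (node l r k s)) a
    end).

Lemma finj_linear t : linear (@finj t).
Proof.
by move=> c x y; exact: (@dinj_linear K ditree (fun t => tpow V (leaves t))).
Qed.

Lemma flift_linear (W : lmodType K) (phi : forall t, tpow V (leaves t) -> W) :
  (forall t, linear (phi t)) -> linear (flift phi).
Proof.
move=> lphi c x y.
exact: (@dlift_linear K ditree (fun t => tpow V (leaves t)) W phi lphi).
Qed.

Lemma flift_inj (W : lmodType K) (phi : forall t, tpow V (leaves t) -> W) t a :
  (forall t, linear (phi t)) -> flift phi (@finj t a) = phi t a.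
Proof. exact: (@dlift_inj K ditree (fun t => tpow V (leaves t))). Qed.

Lemma Fbar_ind (P : Fbar -> Prop) :
  P 0 -> (forall t a x, P x -> P (@finj t a + x)) -> forall x, P x.
Proof. exact: (@dsum_ind K ditree (fun t => tpow V (leaves t))). Qed.

Lemma linear_at0 (U W : lmodType K) (f : U -> W) : linear f -> f 0 = 0.
Proof. by move=> lf; have := lf (-1) 0 0; rewrite !scaleN1r !addNr. Qed.

Lemma linear_at_add (U W : lmodType K) (f : U -> W) :
  linear f -> {morph f : x y / x + y}.
Proof. by move=> lf x y; have := lf 1 x y; rewrite !scale1r. Qed.

Lemma fmul_linear_auxr s t (a : tpow V (leaves t)) u :
  linear (fun b : tpow V (leaves u) => @finj (graft s t u) (tcat a b)).
Proof. by move=> c x y; rewrite tcat_linearr finj_linear. Qed.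

Lemma fmul_linear_auxl s t (y : Fbar) :
  linear (fun a : tpow V (leaves t) =>
    flift (fun u b => @finj (graft s t u) (tcat a b)) y).
Proof.
move=> c a a'; pose phi a0 := flift (fun u b => @finj (graft s t u) (tcat a0 b)).
have L a0 : linear (phi a0).
  by apply: flift_linear => u; exact: fmul_linear_auxr.
change (phi (c *: a + a') y = c *: phi a y + phi a' y).
elim/Fbar_ind: y => [|u b y IHy].
  by rewrite !(linear_at0 (L _)) scaler0 addr0.
rewrite !(linear_at_add (L _)) IHy.
rewrite /phi !flift_inj; try by move=> u'; exact: fmul_linear_auxr.
by rewrite tcat_linearl finj_linear scalerDr addrACA.
Qed.

Lemma fmul_linearl s y : linear (fmul s ^~ y).
Proof. by apply: flift_linear => t; exact: fmul_linear_auxl. Qed.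

Lemma fmul_linearr s x : linear (fmul s x).
Proof.
move=> c y y'; elim/Fbar_ind: x => [|t a x IHx].
  by rewrite !(linear_at0 (fmul_linearl s _)) scaler0 addr0.
rewrite !(linear_at_add (fmul_linearl s _)) IHx.
rewrite /fmul !flift_inj; try by move=> t'; exact: fmul_linear_auxl.
rewrite (flift_linear (fun u => @fmul_linear_auxr s t a u)).
by rewrite scalerDr addrACA.
Qed.

Lemma fmul_gen s t u (x : (leaves t).-tuple V) (y : (leaves u).-tuple V) :
  fmul s (fgen x) (fgen y) = @fgen (graft s t u) [tuple of x ++ y].
Proof.
rewrite /fmul /fgen flift_inj; last by move=> t'; exact: fmul_linear_auxl.
by rewrite flift_inj ?tcat_pure// => u'; exact: fmul_linear_auxr.
Qed.

Hypothesis alpha_linear : linear alpha.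

Lemma falpha_linear_aux t :
  linear (match t return tpow V (leaves t) -> Fbar with
    | leaf => fun a => @finj leaf (tmap alpha a)
    | node l r k s => fun a => @finj (add_weight 1 (node l r k s)) a
    end).
Proof.
case: t => [|l r k s] c a b; last exact: finj_linear.
by rewrite tmap_linear// finj_linear.
Qed.

Lemma falpha_linear : linear falpha.
Proof. exact/flift_linear/falpha_linear_aux. Qed.

Lemma falpha_eta x : falpha (feta x) = feta (alpha x).
Proof.
rewrite /falpha flift_inj; last exact: falpha_linear_aux.
by rewrite tmap_pure//; congr (finj (tpure _)); exact: val_inj.
Qed.

Lemma falpha_gen l r k s (x : (leaves l + leaves r).-tuple V) :
  falpha (@fgen (node l r k s) x) = @fgen (add_weight 1 (node l r k s)) x.
Proof. by rewrite /falpha /fgen flift_inj//; exact: falpha_linear_aux. Qed.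

Definition is_ideal (J : Fbar -> Prop) : Prop :=
  is_submod J /\ forall s x y, J y -> J (fmul s x y) /\ J (fmul s y x).

Definition ideal_gen (S : set Fbar) : set Fbar := smallest is_ideal S.

(* The map on the third tensor power of Fbar given on pure tensors by f. *)
Definition trilin (f : Fbar -> Fbar -> Fbar -> Fbar) : tpow Fbar 3 -> Fbar :=
  tlift (fun t : 3.-tuple Fbar => f t`_0 t`_1 t`_2).

Lemma trilin_pure (f : Fbar -> Fbar -> Fbar -> Fbar) (t : 3.-tuple Fbar) :
    (forall y z, linear (fun x => f x y z)) ->
    (forall x z, linear (fun y => f x y z)) ->
    (forall x y, linear (f x y)) ->
  trilin f (tpure t) = f t`_0 t`_1 t`_2.
Proof.
move=> l1 l2 l3; apply: (tlift_pure (phi := fun t : 3.-tuple Fbar => f t`_0 t`_1 t`_2)).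
move=> {}t i a x y.
have E (k : 'I_3) z : (tset t i z)`_k = if k == i then z else t`_k.
  by rewrite -!tnth_nth tnth_mktuple.
have {E} E z : [/\ (tset t i z)`_0 = if 0%N == i then z else t`_0,
    (tset t i z)`_1 = if 1%N == i then z else t`_1
  & (tset t i z)`_2 = if 2%N == i then z else t`_2].
  by split; [have := E (@Ordinal 3 0 isT) z | have := E (@Ordinal 3 1 isT) z
    | have := E (@Ordinal 3 2 isT) z].
have [-> -> ->] := E x; have [-> -> ->] := E y; have [-> -> ->] := E (a *: x + y).
by case: i {E} => [[|[|[|//]]] ?] /=; [exact: l1 | exact: l2 | exact: l3].
Qed.

End Fbar.

Definition Fbar_map (K : fieldType) (V W : lmodType K) (f : V -> W) :
    Fbar V -> Fbar W :=
  flift (fun t a => @finj K W t (tmap f a)).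

Section Universal.
Variables (K : fieldType) (L : homLeib K).

Local Notation F := (Fbar L).

Definition alpha_F : F -> F := falpha (@hl_alpha K L).

Local Notation al := alpha_F.
Local Notation "x ⊣ y" := (fmul ldi (x : F) (y : F)) (at level 40).
Local Notation "x ⊢ y" := (fmul rdi (x : F) (y : F)) (at level 40).

Definition I_gens : set F :=
  range (trilin (fun x y z : F => (x ⊣ y) ⊣ al z - al x ⊣ (y ⊣ z))) `|`
  range (trilin (fun x y z : F => (x ⊣ y) ⊣ al z - al x ⊣ (y ⊢ z))) `|`
  range (trilin (fun x y z : F => (x ⊢ y) ⊣ al z - al x ⊢ (y ⊣ z))) `|`
  range (trilin (fun x y z : F => al x ⊢ (y ⊢ z) - (x ⊢ y) ⊢ al z)) `|`
  range (trilin (fun x y z : F => al x ⊢ (y ⊢ z) - (x ⊣ y) ⊢ al z)) `|`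
  [set r | exists x y : L,
     r = feta (hl_br x y) - (feta x ⊣ feta y - feta y ⊢ feta x)].

(* I_seq n is the ideal written I^(n+1). *)
Fixpoint I_seq (n : nat) : set F :=
  if n is m.+1 then ideal_gen (I_seq m `|` al @` I_seq m) else ideal_gen I_gens.

Definition I_infty : set F := \bigcup_n I_seq n.

Lemma ideal_gen_submod (S : set F) : is_submod (ideal_gen S).
Proof.
split=> [J [[[J0 _] _] _] //|a u v Su Sv J JS].
by apply: JS.1.1.2; [apply: Su | apply: Sv].
Qed.

Lemma I_seq_submod n : is_submod (I_seq n).
Proof. by case: n => [|n]; exact: ideal_gen_submod. Qed.

Lemma I_seq_mono n m : (n <= m)%N -> I_seq n `<=` I_seq m.
Proof.
elim: m => [|m IHm]; first by rewrite leqn0 => /eqP ->.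
rewrite leq_eqVlt => /orP[/eqP -> //|/IHm nm].
by apply: subset_trans nm _ => x Ix; apply: sub_gen_smallest; left.
Qed.

Lemma I_infty_submod : is_submod I_infty.
Proof.
split=> [|a u v [n _ nu] [m _ mv]]; first by exists 0%N => //; exact: (I_seq_submod 0).1.
exists (maxn n m) => //; apply: (I_seq_submod _).2.
  exact: I_seq_mono (leq_maxl _ _) _ nu.
exact: I_seq_mono (leq_maxr _ _) _ mv.
Qed.

Definition U_mod : lmodType K := lquot (Submod I_infty_submod).

Definition U_pi : F -> U_mod := lpi (Submod I_infty_submod).

(* The induced maps, computed on representatives. *)
Definition U_mul (s : side) (u v : U_mod) : U_mod :=
  U_pi (fmul s (lrepr u) (lrepr v)).

Definition U_alpha (u : U_mod) : U_mod := U_pi (al (lrepr u)).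

End Universal.

Arguments alpha_F {K} L _.
Arguments I_infty {K} L _.
Arguments U_pi {K} L _.
Arguments U_mul {K} L s u v.
Arguments U_alpha {K} L u.

(* Main.v *)
(** The algebra [Fbar V] is freely generated by [V] under the two products and
[falpha]: every compatible linear map from [V] to a module with two bilinear
products and a linear endomorphism extends uniquely, by evaluating diweighted
trees. If the target is a Hom-dialgebra and the map is a morphism from the
Hom-Leibniz algebra [L], the kernel of the extension is an ideal closed under
[alpha_F] that contains the generators of I^1; hence it contains I^oo, the
smallest such ideal. So U(L) is the universal Hom-dialgebra under [L], with
unit x |-> class of x, and both naturality and functoriality follow by comparing
morphisms on the image of the unit. *)

Require Import Defs.
From mathcomp Require Import all_boot all_order all_algebra.
From mathcomp Require Import boolp classical_sets freeg.

Set Implicit Arguments.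
Unset Strict Implicit.
Unset Printing Implicit Defensive.

Import GRing.Theory.
Local Open Scope ring_scope.

(** * Preliminaries on linear maps and tuples *)

Lemma linear_at_sub (K : fieldType) (U W : lmodType K) (f : U -> W) :
  linear f -> {morph f : x y / x - y}.
Proof. by move=> lf x y; rewrite addrC -(scaleN1r y) lf scaleN1r addrC. Qed.

Lemma linear_iter (K : fieldType) (U : lmodType K) (f : U -> U) n :
  linear f -> linear (iter n f).
Proof. by move=> lf a x y; elim: n => //= n ->; rewrite lf. Qed.

Lemma submodD (K : fieldType) (M : lmodType K) (N : M -> Prop) x y :
  is_submod N -> N x -> N y -> N (x + y).
Proof. by move=> sN Nx Ny; rewrite -[x]scale1r; exact: sN.2. Qed.

Lemma tuple_cat_split T n m (t : (n + m)%N.-tuple T) :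
  exists t1 : n.-tuple T, exists t2 : m.-tuple T, t = [tuple of t1 ++ t2].
Proof.
have s1 : size (take n t) == n by rewrite size_takel// size_tuple leq_addr.
have s2 : size (drop n t) == m by rewrite size_drop size_tuple addKn.
by exists (Tuple s1), (Tuple s2); apply: val_inj; rewrite /= cat_take_drop.
Qed.

Lemma tuple1_eta T (x : 1.-tuple T) : x = [tuple thead x].
Proof. by case/tupleP: x => a t; rewrite theadE tuple0; exact: val_inj. Qed.

(** * Generation of [Fbar V] by [V], and uniqueness of morphisms out of it *)

Section FbarGenerators.
Variables (K : fieldType) (V : lmodType K).
Implicit Types W : lmodType K.

Lemma fgen_ind (P : Fbar V -> Prop) : is_submod P ->
  (forall t (x : (leaves t).-tuple V), P (fgen x)) -> forall x, P x.
Proof.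
move=> sP Pgen; elim/Fbar_ind => [|t a x Px]; first exact: sP.1.
apply: submodD => //; elim/tpow_ind: a => [|b u y Py].
  by rewrite (linear_at0 (@finj_linear K V t)); exact: sP.1.
by rewrite finj_linear; apply: sP.2 => //; exact: Pgen.
Qed.

Lemma fgen_ext W (g h : Fbar V -> W) : linear g -> linear h ->
  (forall t (x : (leaves t).-tuple V), g (fgen x) = h (fgen x)) -> g =1 h.
Proof.
move=> lg lh gh; apply: fgen_ind => //; split=> [|a u v gu gv].
  by rewrite !linear_at0.
by rewrite lg lh gu gv.
Qed.

(** Induction on the tree, then on the weight of its root: a root of weight 0 is a product of the
    two subtrees, and each further unit of weight is one application of [falpha]. *)
Lemma Fbar_generated (alpha : V -> V) (P : Fbar V -> Prop) :
    linear alpha -> is_submod P -> (forall x, P (feta x)) ->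
    (forall s x y, P x -> P y -> P (fmul s x y)) ->
    (forall x, P x -> P (falpha alpha x)) ->
  forall x, P x.
Proof.
move=> la sP Peta Pmul Pal; apply: fgen_ind => //.
elim=> [|l IHl r IHr k s] x.
  by rewrite [x]tuple1_eta; exact: Peta.
elim: k x => [|k IHk] x.
  have [x1 [x2 ->]] := tuple_cat_split x.
  by rewrite -[fgen _](@fmul_gen K V s l r); exact: Pmul.
have := Pal _ (IHk x); rewrite falpha_gen//=.
by rewrite addn1.
Qed.

Lemma Fbar_hom_ext (alpha : V -> V) W (m : side -> W -> W -> W) (al : W -> W)
    (g h : Fbar V -> W) : linear alpha ->
    linear g -> (forall s, {morph g : x y / fmul s x y >-> m s x y}) ->
    {morph g : x / falpha alpha x >-> al x} ->
    linear h -> (forall s, {morph h : x y / fmul s x y >-> m s x y}) ->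
    {morph h : x / falpha alpha x >-> al x} ->
  (forall x, g (feta x) = h (feta x)) -> g =1 h.
Proof.
move=> la lg gm ga lh hm ha gh; apply: (Fbar_generated la) => //.
- split=> [|a u v gu gv]; first by rewrite !linear_at0.
  by rewrite lg lh gu gv.
- by move=> s x y gx gy; rewrite gm hm gx gy.
- by move=> x gx; rewrite ga ha gx.
Qed.

Lemma feta_linear : linear (@feta K V).
Proof.
move=> a x y; rewrite /feta /fgen -finj_linear; congr finj.
(* Presenting a one-entry tuple as a [tset] makes multilinearity of [tpure] applicable; the
   overwritten entry 0 is arbitrary. *)
have E z : [tuple z] = tset [tuple 0] ord0 z :> 1.-tuple V.
  by apply: eq_from_tnth => j; rewrite tnth_mktuple !ord1 eqxx.
by rewrite (E (_ + _)) tpure_multilinear -!E.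
Qed.

End FbarGenerators.

(** * Extension of a linear map on [V] to [Fbar V] *)

Section FbarLift.
Variables (K : fieldType) (V : lmodType K) (alpha : V -> V).
Hypothesis alpha_linear : linear alpha.
Variables (D : lmodType K) (m : side -> D -> D -> D) (al : D -> D).
Hypothesis m_bilinear : forall s, is_bilinear (m s).
Hypothesis al_linear : linear al.
Variable f : V -> D.
Hypothesis f_linear : linear f.
Hypothesis f_alpha : {morph f : x / alpha x >-> al x}.

(** Sequences instead of tuples spare the recursive calls any cast on lengths; the default 0 of
    [head] is never reached when [x] has [leaves t] entries. *)
Fixpoint tree_eval (t : ditree) (x : seq V) : D :=
  if t is node l r k s then
    iter k al (m s (tree_eval l (take (leaves l) x))
                   (tree_eval r (drop (leaves l) x)))
  else f (head 0 x).

Lemma tree_eval_cat l r k s (x : (leaves l).-tuple V) (y : seq V) :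
  tree_eval (node l r k s) (x ++ y) =
  iter k al (m s (tree_eval l x) (tree_eval r y)).
Proof. by rewrite /= take_size_cat ?drop_size_cat ?size_tuple. Qed.

Lemma tree_eval_multilinear t :
  multilinear (fun x : (leaves t).-tuple V => tree_eval t x).
Proof.
elim: t => [|l IHl r IHr k s] x i a u v.
  have E z : head 0 (tset x i z) = z.
    by rewrite -nth0 (_ : 0%N = i) ?ord1// -tnth_nth tnth_mktuple eqxx.
  by rewrite /= !E f_linear.
have [x1 [x2 ->]] := tuple_cat_split x.
(* The varied entry lies in exactly one subtree; the other factor stays constant. *)
case: (split_ordP i) => j ->.
  rewrite -!tset_lshift !tree_eval_cat IHl (m_bilinear s).2.
  exact: linear_iter.
rewrite -!tset_rshift !tree_eval_cat IHr (m_bilinear s).1.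
exact: linear_iter.
Qed.

Definition fext : Fbar V -> D :=
  flift (fun t => tlift (fun x : (leaves t).-tuple V => tree_eval t x)).

Lemma fext_linear : linear fext.
Proof. by apply: flift_linear => t; exact/tlift_linear/tree_eval_multilinear. Qed.

Lemma fext_gen t (x : (leaves t).-tuple V) : fext (fgen x) = tree_eval t x.
Proof.
rewrite /fext /fgen flift_inj ?(tlift_pure (@tree_eval_multilinear t))//.
by move=> u; exact/tlift_linear/tree_eval_multilinear.
Qed.

Lemma fext_eta x : fext (feta x) = f x.
Proof. exact: fext_gen. Qed.

(** By linearity in each argument it suffices to compare on generators, where the new root has
    weight 0 and so no [al] is applied. *)
Lemma fext_mul s : {morph fext : x y / fmul s x y >-> m s x y}.
Proof.
move=> x y; apply: (fgen_ext (g := fun x => fext (fmul s x y))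
                            (h := fun x => m s (fext x) (fext y))) x.
- by move=> a u v; rewrite fmul_linearl fext_linear.
- by move=> a u v; rewrite fext_linear (m_bilinear s).2.
move=> t x; apply: (fgen_ext (g := fun y => fext (fmul s (fgen x) y))
                            (h := fun y => m s (fext (fgen x)) (fext y))) y.
- by move=> a u v; rewrite fmul_linearr fext_linear.
- by move=> a u v; rewrite fext_linear (m_bilinear s).1.
by move=> u y; rewrite fmul_gen !fext_gen tree_eval_cat.
Qed.

Lemma fext_alpha : {morph fext : x / falpha alpha x >-> al x}.
Proof.
apply: (fgen_ext (g := fext \o falpha alpha) (h := al \o fext)).
- by move=> a u v; rewrite /= falpha_linear// fext_linear.
- by move=> a u v; rewrite /= fext_linear al_linear.
case=> [|l r k s] x /=.
  by rewrite [x]tuple1_eta -/(feta _) falpha_eta// !fext_eta f_alpha.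
by rewrite falpha_gen// !fext_gen /= addn1.
Qed.

End FbarLift.

(** * Functoriality of [Fbar] *)

Section FbarMap.
Variables (K : fieldType) (V W : lmodType K) (f : V -> W).
Hypothesis f_linear : linear f.

Lemma Fbar_map_linear : linear (Fbar_map f).
Proof.
by apply: flift_linear => t a x y; rewrite tmap_linear// finj_linear.
Qed.

Lemma Fbar_map_gen t (x : (leaves t).-tuple V) :
  Fbar_map f (fgen x) = @fgen K W t [tuple of map f x].
Proof.
rewrite /Fbar_map /fgen flift_inj ?tmap_pure// => u a y z.
by rewrite tmap_linear// finj_linear.
Qed.

Lemma Fbar_map_eta x : Fbar_map f (feta x) = feta (f x).
Proof. by rewrite Fbar_map_gen; congr fgen; exact: val_inj. Qed.

Lemma Fbar_map_mul s : {morph Fbar_map f : x y / fmul s x y >-> fmul s x y}.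
Proof.
move=> x y; apply: (fgen_ext (g := fun x => Fbar_map f (fmul s x y))
                    (h := fun x => fmul s (Fbar_map f x) (Fbar_map f y))) x.
- by move=> a u v; rewrite fmul_linearl Fbar_map_linear.
- by move=> a u v; rewrite Fbar_map_linear fmul_linearl.
move=> t x; apply: (fgen_ext (g := fun y => Fbar_map f (fmul s (fgen x) y))
            (h := fun y => fmul s (Fbar_map f (fgen x)) (Fbar_map f y))) y.
- by move=> a u v; rewrite fmul_linearr Fbar_map_linear.
- by move=> a u v; rewrite Fbar_map_linear fmul_linearr.
move=> u y; rewrite fmul_gen !Fbar_map_gen fmul_gen.
by congr fgen; apply: val_inj; rewrite /= map_cat.
Qed.

(** Compatibility of [f] with the twisting maps enters only at the leaf; elsewhere [falpha] changes
    the tree and [Fbar_map] only the entries. *)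
Lemma Fbar_map_alpha (aV : V -> V) (aW : W -> W) :
    linear aV -> linear aW -> {morph f : x / aV x >-> aW x} ->
  {morph Fbar_map f : x / falpha aV x >-> falpha aW x}.
Proof.
move=> lV lW fa; apply: (fgen_ext (g := Fbar_map f \o falpha aV)
                                  (h := falpha aW \o Fbar_map f)).
- by move=> a u v; rewrite /= falpha_linear// Fbar_map_linear.
- by move=> a u v; rewrite /= Fbar_map_linear falpha_linear.
case=> [|l r k s] x /=; last by rewrite falpha_gen// !Fbar_map_gen falpha_gen.
by rewrite [x]tuple1_eta -/(feta _) falpha_eta// !Fbar_map_eta falpha_eta// fa.
Qed.

End FbarMap.

(** * Images of trilinear maps *)

(** By definition [tlift] is a finite linear combination of values of [f], taken over a
    representative of [w]. *)
Lemma trilin_in (K : fieldType) (V : lmodType K) (J : Fbar V -> Prop)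
    (f : Fbar V -> Fbar V -> Fbar V -> Fbar V) w :
  is_submod J -> (forall x y z, J (f x y z)) -> J (trilin f w).
Proof.
move=> sJ Jf; rewrite /trilin /tlift -[lrepr w]freeg_sumE linear_sum /=.
elim: (dom _) => [|t s IHs]; first by rewrite big_nil; exact: sJ.1.
by rewrite big_cons liftU; exact: sJ.2.
Qed.

(** Trilinearity ensures that [trilin f] really takes the value [f x y z] on the pure tensor. *)
Lemma trilin_range (K : fieldType) (V : lmodType K)
    (f : Fbar V -> Fbar V -> Fbar V -> Fbar V) :
    (forall y z, linear (fun x => f x y z)) ->
    (forall x z, linear (fun y => f x y z)) ->
    (forall x y, linear (f x y)) ->
  forall x y z, range (trilin f) (f x y z).
Proof.
by move=> l1 l2 l3 x y z; exists (tpure [tuple x; y; z]); rewrite // trilin_pure.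
Qed.

(** * [I_infty] as the smallest [alpha_F]-closed ideal containing the generators *)

Section IdealInfty.
Variables (K : fieldType) (L : homLeib K).

Lemma alpha_F_linear : linear (alpha_F L).
Proof. exact: falpha_linear (homLeib_linear (hl_axioms L)). Qed.

Lemma ideal_gen_ideal (S : set (Fbar L)) : is_ideal (ideal_gen S).
Proof.
split=> [|s x y Sy]; first exact: ideal_gen_submod.
by split=> J JS; have [] := JS.1.2 s x y (Sy J JS).
Qed.

Lemma I_seq_ideal n : is_ideal (@I_seq K L n).
Proof. by case: n => [|n]; exact: ideal_gen_ideal. Qed.

Lemma I_infty_ideal : is_ideal (I_infty L).
Proof.
split=> [|s x y [n _ ny]]; first exact: I_infty_submod.
(* Each stage is already an ideal, so products stay in the stage of [y]. *)
by have [_ /(_ s x y ny) [? ?]] := I_seq_ideal n; split; exists n.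
Qed.

Lemma I_infty_alpha x : I_infty L x -> I_infty L (alpha_F L x).
Proof.
by move=> [n _ nx]; exists n.+1 => //; apply: sub_gen_smallest; right; exists x.
Qed.

Lemma I_infty_gens x : I_gens x -> I_infty L x.
Proof. by exists 0%N => //; exact: sub_gen_smallest. Qed.

(** Induction on the stage: each one is the least ideal containing elements already known to lie in
    [J]. *)
Lemma I_infty_min (J : Fbar L -> Prop) : is_ideal J ->
    (forall x, J x -> J (alpha_F L x)) -> (forall x, I_gens x -> J x) ->
  forall x, I_infty L x -> J x.
Proof.
move=> iJ aJ gJ x [n _]; elim: n x => [|n IHn] x.
  exact: (smallest_sub iJ gJ).
by apply: (smallest_sub iJ) => y [/IHn //|[z /IHn Jz <-]]; exact: aJ.
Qed.

End IdealInfty.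

(** * The quotient Hom-dialgebra *)

Section Quotient.
Variables (K : fieldType) (L : homLeib K).
Local Notation pi := (U_pi L).
Local Notation al := (alpha_F L).

Lemma U_piP (u : U_mod L) : exists x, u = pi x.
Proof. by exists (lrepr u); rewrite /U_pi lreprK. Qed.

Lemma U_pi_linear : linear pi.
Proof. exact: lpi_linear. Qed.

Lemma U_pi_eq x y : pi x = pi y <-> I_infty L (x - y).
Proof. exact: lpi_eq. Qed.

Lemma U_pi_repr x : I_infty L (x - lrepr (pi x)).
Proof. by apply/U_pi_eq; rewrite /U_pi lreprK. Qed.

(** This is well-definedness of the product: exchanging the factors for their representatives one at
    a time leaves two terms, each with a factor in the ideal. *)
Lemma U_pi_mul s : {morph pi : x y / fmul s x y >-> U_mul L s x y}.
Proof.
move=> x y; apply/U_pi_eq; set x' := lrepr _; set y' := lrepr _.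
have -> : fmul s x y - fmul s x' y' = fmul s (x - x') y + fmul s x' (y - y').
  rewrite (linear_at_sub (fmul_linearl s _)) (linear_at_sub (fmul_linearr s _)).
  by rewrite addrA subrK.
have [sI mI] := I_infty_ideal L.
apply: submodD => //.
  by have [] := mI s y _ (U_pi_repr x).
by have [] := mI s x' _ (U_pi_repr y).
Qed.

Lemma U_pi_alpha : {morph pi : x / al x >-> U_alpha L x}.
Proof.
move=> x; apply/U_pi_eq; rewrite -(linear_at_sub (@alpha_F_linear K L)).
exact/I_infty_alpha/U_pi_repr.
Qed.

Lemma U_pi_br (x y : L) : pi (feta (hl_br x y)) =
  U_mul L ldi (pi (feta x)) (pi (feta y)) - U_mul L rdi (pi (feta y)) (pi (feta x)).
Proof.
rewrite -!U_pi_mul -(linear_at_sub U_pi_linear); apply/U_pi_eq.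
by apply: I_infty_gens; right; exists x, y.
Qed.

Lemma U_mul_bilinear s : is_bilinear (U_mul L s).
Proof.
split=> [x|y] a u v; have [u' ->] := U_piP u; have [v' ->] := U_piP v.
  have [x' ->] := U_piP x.
  by rewrite -U_pi_linear -!U_pi_mul -U_pi_linear fmul_linearr.
have [y' ->] := U_piP y.
by rewrite -U_pi_linear -!U_pi_mul -U_pi_linear fmul_linearl.
Qed.

Lemma U_alpha_linear : linear (U_alpha L).
Proof.
move=> a u v; have [u' ->] := U_piP u; have [v' ->] := U_piP v.
by rewrite -U_pi_linear -!U_pi_alpha -U_pi_linear alpha_F_linear.
Qed.

(** Supplies the premises of [trilin_range] for the first three families of generators at once. *)
Lemma trilin_associator (s1 s2 s3 s4 : side) :
  let f := fun x y z : Fbar L =>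
    fmul s2 (fmul s1 x y) (al z) - fmul s4 (al x) (fmul s3 y z) in
  [/\ forall y z, linear (fun x => f x y z), forall x z, linear (fun y => f x y z)
    & forall x y, linear (f x y)].
Proof.
split=> [y z|x z|x y] a u v /=.
- rewrite alpha_F_linear !fmul_linearl.
  by rewrite scalerBr opprD addrACA.
- rewrite !(fmul_linearl _ z) fmul_linearr fmul_linearl fmul_linearr.
  by rewrite scalerBr opprD addrACA.
rewrite alpha_F_linear !fmul_linearr.
by rewrite scalerBr opprD addrACA.
Qed.

(* The last two families of generators of I^1 carry the opposite sign. *)
Lemma trilin_associatorN (s1 s2 s3 s4 : side) :
  let f := fun x y z : Fbar L =>
    fmul s4 (al x) (fmul s3 y z) - fmul s2 (fmul s1 x y) (al z) in
  [/\ forall y z, linear (fun x => f x y z), forall x z, linear (fun y => f x y z)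
    & forall x y, linear (f x y)].
Proof.
have [l1 l2 l3] := trilin_associator s1 s2 s3 s4.
have E b (p q r u v w : Fbar L) : p - q = b *: (r - u) + (v - w) ->
    q - p = b *: (u - r) + (w - v).
  by move=> /(congr1 -%R); rewrite opprB opprD -scalerN !opprB.
by split=> [y z|x z|x y] a u v /=; apply: E;
  [exact: (l1 y z) | exact: (l2 x z) | exact: (l3 x y)].
Qed.

Lemma U_homDi : is_homDi (U_mul L ldi) (U_mul L rdi) (U_alpha L).
Proof.
(* [E] and [EN] turn membership of a generator in [I_infty] into an axiom on classes, one for each
   sign. *)
have E (x y z : Fbar L) (s1 s2 s3 s4 : side) :
    I_infty L (fmul s2 (fmul s1 x y) (al z) - fmul s4 (al x) (fmul s3 y z)) ->
    U_mul L s2 (U_mul L s1 (pi x) (pi y)) (U_alpha L (pi z)) =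
    U_mul L s4 (U_alpha L (pi x)) (U_mul L s3 (pi y) (pi z)).
  move=> Ixyz.
  by rewrite -!U_pi_alpha -(U_pi_mul s1 x y) -(U_pi_mul s3 y z) -!U_pi_mul; apply/U_pi_eq.
have EN (x y z : Fbar L) (s1 s2 s3 s4 : side) :
    I_infty L (fmul s4 (al x) (fmul s3 y z) - fmul s2 (fmul s1 x y) (al z)) ->
    U_mul L s2 (U_mul L s1 (pi x) (pi y)) (U_alpha L (pi z)) =
    U_mul L s4 (U_alpha L (pi x)) (U_mul L s3 (pi y) (pi z)).
  move=> Ixyz.
  by rewrite -!U_pi_alpha -(U_pi_mul s1 x y) -(U_pi_mul s3 y z) -!U_pi_mul; apply/esym/U_pi_eq.
have tA s1 s2 s3 s4 := trilin_associator s1 s2 s3 s4.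
have tN s1 s2 s3 s4 := trilin_associatorN s1 s2 s3 s4.
split; try exact: U_mul_bilinear; try exact: U_alpha_linear;
  move=> u v w;
  have [x ->] := U_piP u; have [y ->] := U_piP v; have [z ->] := U_piP w.
(* The union [I_gens] nests to the left, so the number of [left] selects the family; [esym] adjusts
   the orientation of the axiom. *)
- apply/esym/E/I_infty_gens; do 5!left.
  by have [? ? ?] := tA ldi ldi ldi ldi; exact: trilin_range.
- apply/E/I_infty_gens; do 4!left; right.
  by have [? ? ?] := tA ldi ldi rdi ldi; exact: trilin_range.
- apply/E/I_infty_gens; do 3!left; right.
  by have [? ? ?] := tA rdi ldi ldi rdi; exact: trilin_range.
- apply/EN/I_infty_gens; left; right.
  by have [? ? ?] := tN ldi rdi rdi rdi; exact: trilin_range.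
- apply/esym/EN/I_infty_gens; do 2!left; right.
  by have [? ? ?] := tN rdi rdi rdi rdi; exact: trilin_range.
Qed.

Definition U_obj : homDi K := HomDi U_homDi.

End Quotient.

(** * Universal property of the quotient, and the adjunction *)

Section Adjunction.
Variable K : fieldType.
Implicit Types (L : homLeib K) (D : homDi K).

Definition hd_mul D (s : side) : D -> D -> D :=
  if s is ldi then @hd_l K D else @hd_r K D.

Lemma hd_mul_bilinear D s : is_bilinear (@hd_mul D s).
Proof. by case: (hd_axioms D) => bl br *; case: s. Qed.

Lemma hd_alpha_linear D : linear (@hd_alpha K D).
Proof. by case: (hd_axioms D). Qed.

Lemma homDi_hom_mul D D' (h : homDi_hom D D') s :
  {morph h : x y / hd_mul s x y >-> hd_mul s x y}.
Proof. by case: s; [exact: hd_fun_l | exact: hd_fun_r]. Qed.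

(** Composition with the surjection [U_pi] reduces this to uniqueness of morphisms out of
    [Fbar L]. *)
Lemma U_hom_ext L D (g h : homDi_hom (U_obj L) D) :
  (forall x, g (U_pi L (feta x)) = h (U_pi L (feta x))) -> g = h.
Proof.
move=> gh; apply: homDi_hom_eq => u; have [x ->] := U_piP u.
have lin (k : homDi_hom (U_obj L) D) : linear (k \o U_pi L).
  by move=> a y z; rewrite /= U_pi_linear hd_fun_linear.
have mul (k : homDi_hom (U_obj L) D) s :
    {morph k \o U_pi L : y z / fmul s y z >-> hd_mul s y z}.
  by move=> y z; rewrite /= U_pi_mul -homDi_hom_mul; case: s.
have alph (k : homDi_hom (U_obj L) D) :
    {morph k \o U_pi L : y / alpha_F L y >-> hd_alpha y}.
  by move=> y; rewrite /= U_pi_alpha -hd_fun_alpha.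
exact: (Fbar_hom_ext (homLeib_linear (hl_axioms L)) (lin g) (mul g) (alph g)
                     (lin h) (mul h) (alph h) gh).
Qed.

(** * The morphism out of the quotient induced by [f] *)

Section Lift.
Variables (L : homLeib K) (D : homDi K) (f : homLeib_hom L (HLeib_obj D)).

Let F : Fbar L -> D := fext (@hd_mul D) (@hd_alpha K D) f.

Let lL := homLeib_linear (hl_axioms L).

Let F_linear : linear F.
Proof.
exact (fext_linear (@hd_mul_bilinear D) (@hd_alpha_linear D) (hl_fun_linear f)).
Qed.

Let F_eta x : F (feta x) = f x.
Proof.
exact (fext_eta (@hd_mul_bilinear D) (@hd_alpha_linear D) (hl_fun_linear f) _).
Qed.

Let F_mul s : {morph F : x y / fmul s x y >-> hd_mul s x y}.
Proof.
exact (fext_mul (@hd_mul_bilinear D) (@hd_alpha_linear D) (hl_fun_linear f) s).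
Qed.

Let F_alpha : {morph F : x / alpha_F L x >-> hd_alpha x}.
Proof.
exact (fext_alpha lL (@hd_mul_bilinear D) (@hd_alpha_linear D)
  (hl_fun_linear f) (hl_fun_alpha f)).
Qed.

Lemma I_infty_ker x : I_infty L x -> F x = 0.
Proof.
have sF : is_submod (fun x => F x = 0).
  split=> [|a u v Fu Fv]; first exact: linear_at0.
  by rewrite F_linear Fu Fv scaler0 addr0.
apply: (I_infty_min (J := fun x => F x = 0)) => {x} [|x Fx|].
- split=> // s x y Fy.
  rewrite !F_mul Fy (linear_at0 ((hd_mul_bilinear D s).1 _)).
  by rewrite (linear_at0 ((hd_mul_bilinear D s).2 _)).
- by rewrite F_alpha Fx (linear_at0 (@hd_alpha_linear D)).
case: (hd_axioms D) => _ _ _ ll lr rl lrr rr x.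
(* The bracket generators come first: they vanish because [f] preserves brackets and the bracket of
   [HLeib_obj D] unfolds to the difference of products. *)
case=> [[[[[|]|]|]|]|[y [z ->]]]; last first.
  rewrite !(linear_at_sub F_linear) !F_mul !F_eta hl_fun_br.
  exact: subrr.
(* For the other five families [trilin_in] passes from tensors to triples, where the axioms of [D]
   apply. *)
all: case=> w _ <-; apply: (trilin_in (J := fun x => F x = 0)) => // {w} x1 x2 x3.
all: rewrite (linear_at_sub F_linear) !F_mul !F_alpha /=; apply/eqP.
all: by rewrite subr_eq0 ?(ll, lr, rl, lrr, rr).
Qed.

Definition U_lift_fun (u : U_obj L) : D := F (lrepr u).

Lemma U_lift_pi x : U_lift_fun (U_pi L x) = F x.
Proof.
by apply/eqP; rewrite eq_sym -subr_eq0 -(linear_at_sub F_linear);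
  apply/eqP/I_infty_ker/U_pi_repr.
Qed.

Lemma U_lift_linear : linear U_lift_fun.
Proof.
move=> a u v; have [x ->] := U_piP u; have [y ->] := U_piP v.
by rewrite -U_pi_linear !U_lift_pi F_linear.
Qed.

Lemma U_lift_mul s (u v : U_obj L) :
  U_lift_fun (U_mul L s u v) = hd_mul s (U_lift_fun u) (U_lift_fun v).
Proof.
have [x ->] := U_piP u; have [y ->] := U_piP v.
by rewrite -U_pi_mul !U_lift_pi F_mul.
Qed.

Lemma U_lift_alpha (u : U_obj L) :
  U_lift_fun (U_alpha L u) = hd_alpha (U_lift_fun u).
Proof. by have [x ->] := U_piP u; rewrite -U_pi_alpha !U_lift_pi F_alpha. Qed.

Definition U_lift : homDi_hom (U_obj L) D :=
  @HomDiHom K (U_obj L) D U_lift_fun U_lift_linear (U_lift_mul ldi)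
    (U_lift_mul rdi) U_lift_alpha.

Lemma U_lift_eta x : U_lift (U_pi L (feta x)) = f x.
Proof. by rewrite /= U_lift_pi F_eta. Qed.

End Lift.

(** * The unit, the functor and the natural bijection *)

Definition U_unit L : homLeib_hom L (HLeib_obj (U_obj L)).
Proof.
exists (U_pi L \o @feta K L) => [a x y|x y|x] /=.
- by rewrite feta_linear U_pi_linear.
- exact: U_pi_br.
rewrite -U_pi_alpha /alpha_F falpha_eta//.
exact: homLeib_linear (hl_axioms L).
Defined.

(** Going through the universal property gives the morphism axioms at once; [U_hom_pi] then
    identifies the result with the map induced by [Fbar_map f]. *)
Definition U_hom L L' (f : homLeib_hom L L') : homDi_hom (U_obj L) (U_obj L') :=
  U_lift (homLeib_comp (U_unit L') f).

Lemma U_hom_eta L L' (f : homLeib_hom L L') x :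
  U_hom f (U_pi L (feta x)) = U_pi L' (feta (f x)).
Proof. exact: U_lift_eta. Qed.

(** Both sides, as functions of [x], are compatible with the operations of [Fbar L] and agree on
    [feta], so [Fbar_hom_ext] applies. *)
Lemma U_hom_pi L L' (f : homLeib_hom L L') x :
  U_hom f (U_pi L x) = U_pi L' (Fbar_map f x).
Proof.
have lf := hl_fun_linear f.
have lL := homLeib_linear (hl_axioms L).
have lL' := homLeib_linear (hl_axioms L').
apply: (Fbar_hom_ext (g := U_hom f \o U_pi L) (h := U_pi L' \o Fbar_map f)
          (m := U_mul L') (al := U_alpha L') lL) => {x}.
- by move=> a x y; rewrite [LHS]/= U_pi_linear; exact: (hd_fun_linear (U_hom f)).
- move=> s x y; rewrite [LHS]/= U_pi_mul.
  by case: s; [exact: (hd_fun_l (U_hom f)) | exact: (hd_fun_r (U_hom f))].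
- by move=> x; rewrite [LHS]/= U_pi_alpha; exact: (hd_fun_alpha (U_hom f)).
- by move=> a x y; rewrite /= Fbar_map_linear// U_pi_linear.
- by move=> s x y; rewrite /= Fbar_map_mul// U_pi_mul.
- move=> x; rewrite /= (Fbar_map_alpha lf lL lL' (hl_fun_alpha f)).
  exact: U_pi_alpha.
by move=> x; rewrite [LHS]U_hom_eta /= Fbar_map_eta.
Qed.

Lemma U_functor : @is_functor (HomLeibCat K) (HomDiCat K) (@U_obj K) U_hom.
Proof.
split=> [L|L1 L2 L3 f g]; apply: U_hom_ext => x; first exact: U_lift_eta.
apply: etrans (U_hom_eta _ x) (esym _).
exact: etrans (congr1 (U_hom f) (U_hom_eta g x)) (U_hom_eta f (g x)).
Qed.

Definition U_adj L D (h : homDi_hom (U_obj L) D) : homLeib_hom L (HLeib_obj D) :=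
  homLeib_comp (HLeib_hom h) (U_unit L).

(** [U_lift] inverts [U_adj]: one composite is the identity by [U_hom_ext], the other by the value
    of a lift on the unit. *)
Lemma U_left_adjoint : left_adjoint (Functor U_functor) (HLeib K).
Proof.
exists U_adj; split=> [L D|L L' D D' f g h].
  exists (@U_lift L D) => [h|f].
    by apply: U_hom_ext => x; rewrite U_lift_eta.
  by apply: homLeib_hom_eq => x; exact: U_lift_eta.
(* Naturality in both variables comes down to naturality of the unit. *)
apply: homLeib_hom_eq => x; congr (g (h _)); exact: U_lift_eta.
Qed.

End Adjunction.

Theorem theorem6p3 (K : fieldType) (charK : [pchar K] =i pred0) :
  (forall L : homLeib K,
     is_ideal (I_infty L) /\
     forall x : Fbar L, I_infty L x -> I_infty L (alpha_F L x)) /\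
  (forall L : homLeib K,
     (forall s : side, {morph U_pi L : x y / fmul s x y >-> U_mul L s x y}) /\
     {morph U_pi L : x / alpha_F L x >-> U_alpha L x}) /\
  (exists U_homDi : forall L : homLeib K,
     is_homDi (U_mul L ldi) (U_mul L rdi) (U_alpha L),
   let U_obj (L : homLeib K) : homDi K := HomDi (U_homDi L) in
   exists (U_hom : forall L L' : homLeib K,
             homLeib_hom L L' -> homDi_hom (U_obj L) (U_obj L'))
          (U_functor : @is_functor (HomLeibCat K) (HomDiCat K) U_obj U_hom),
     (forall (L L' : homLeib K) (f : homLeib_hom L L') (x : Fbar L),
        U_hom L L' f (U_pi L x) = U_pi L' (Fbar_map f x)) /\
     left_adjoint (Functor U_functor) (HLeib K)).
Proof.
split; first by move=> L; split; [exact: I_infty_ideal | exact: I_infty_alpha].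
split; first by move=> L; split; [exact: U_pi_mul | exact: U_pi_alpha].
exists (@U_homDi K), (@U_hom K), (@U_functor K).
by split; [exact: U_hom_pi | exact: U_left_adjoint].
Qed.
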